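(* For every integer $d\ge 2$, two firefighters suffice to contain a fire on the infinite hexagonal grid $G_{\mathrm{hex}}$ in the distance-$d$ firefighter game; that is, $f_d(G_{\mathrm{hex}}) \le 2$.
   Context: $G_{\mathrm{hex}}$ (the symbol's subscript denotes a hexagon) is the infinite hexagonal grid, i.e. the infinite $3$-regular graph of the tiling of the plane by regular hexagons; equivalently, up to isomorphism, the graph with vertex set $\mathbb{Z}\times\mathbb{Z}$ in which $(x,y)$ is adjacent to $(x\pm 1,y)$, and $(x,y)$ is adjacent to $(x,y+1)$ exactly when $x+y$ is odd. Distance-$d$ (distance-restricted) firefighter game on a graph $G$ with $k$ firefighters and fire at $u$: on turn $0$, the vertex $u$ starts burning, and then the $k$ firefighters are placed on unburnt vertices (several may occupy the same vertex), protecting the vertices they occupy. On each turn $t+1$ ($t\ge 0$), first the fire spreads to every unburnt, unprotected neighbour of every burning vertex; then each firefighter moves from its current vertex to an unburnt vertex at distance at most $d$ (possibly staying put, and several may occupy the same vertex), where the distance is measured in the subgraph of $G$ induced by the currently unburnt vertices (firefighters may not move through the fire), and protects the vertex it arrives at. Once a vertex is burning or protected it remains so for the rest of the game. The fire is contained if after finitely many turns a point is reached where the fire can no longer spread (no burning vertex has an unburnt, unprotected neighbour). $f_d(G,u)$ is the minimum $k$ for which a fire breaking out at $u$ can be contained; for a vertex-transitive graph $G$ this does not depend on $u$ and is written $f_d(G)$. *)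

(* Defs.v *)
From mathcomp Require Import all_boot all_order all_algebra.

Set Implicit Arguments.
Unset Strict Implicit.
Unset Printing Implicit Defensive.

Import Order.TTheory GRing.Theory Num.Theory.

Definition hex_arc : rel (int * int) := fun p q =>
  ((q == (p.1 + 1, p.2)) ||
   (q == (p.1, p.2 + 1)) && ~~ (2 %| p.1 + p.2)%Z)%R.

Definition hex_adj : rel (int * int) := fun p q => hex_arc p q || hex_arc q p.

Lemma hex_adj_sym : symmetric hex_adj.
Proof. by move=> p q; rewrite /hex_adj orbC. Qed.

Lemma hex_adj_irrefl : irreflexive hex_adj.
Proof.
have E (z : int) : (z == z + 1)%R = false by rewrite lt_eqF // ltrDl.
by move=> [x y]; rewrite /hex_adj /hex_arc !xpair_eqE /= !E !andbF.
Qed.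

Section FirefighterGame.

Variables (V : eqType) (adj : rel V).

(* Distance at most d between x and y in the subgraph induced by A. *)
Definition dist_in_le (A : V -> Prop) (d : nat) (x y : V) : Prop :=
  exists s : seq V,
    [/\ path adj x s, last x s = y, size s <= d
      & forall v, v \in x :: s -> A v].

(* The fire is deterministic, so a strategy is the sequence of positions:
   p t i is where firefighter i stands at the end of turn t. *)
Section Play.

Variables (d k : nat) (u : V) (p : nat -> 'I_k -> V).

Definition protected (t : nat) (v : V) : Prop :=
  exists s i, s <= t /\ p s i = v.

Fixpoint burning (t : nat) (v : V) : Prop :=
  if t is t'.+1 then
    burning t' v \/
    (~ protected t' v /\ exists w, burning t' w /\ adj w v)
  else v = u.

(* The fire spreads before the firefighters move, so the move of turn t.+1
   avoids the vertices burning at t.+1. *)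
Definition legal : Prop :=
  (forall i, ~ burning 0 (p 0 i)) /\
  (forall t i,
     dist_in_le (fun v => ~ burning t.+1 v) d (p t i) (p t.+1 i)).

Definition contained_at (t : nat) : Prop :=
  ~ exists v w, [/\ burning t v, adj v w, ~ burning t w & ~ protected t w].

End Play.

Definition can_contain (d k : nat) (u : V) : Prop :=
  exists p : nat -> 'I_k -> V,
    legal d u p /\ exists t, contained_at u p t.

(* f_d(G, u) = k *)
Definition is_firefighter_number_at (d : nat) (u : V) (k : nat) : Prop :=
  can_contain d k u /\ forall j, can_contain d j u -> k <= j.

(* f_d(G) = k, for G whose f_d(G, u) does not depend on u *)
Definition is_firefighter_number (d k : nat) : Prop :=
  forall u, is_firefighter_number_at d u k.

End FirefighterGame.

(* Main.v *)
Require Import Defs.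
From mathcomp Require Import all_boot all_order all_algebra.
From mathcomp Require Import zify.
From Stdlib Require Import Classical.

(** With the fire at the origin, the two firefighters protect the vertices
    (x, y) and (-x, y) for (x, y) running through
    (1, 0), (2, -1), (3, -2), (2, -3), (0, -3);
    each step has length two and the fire stops after burning nine vertices.
    Translations by vectors of even coordinate sum and point reflections
    through centres c/2, with c of odd coordinate sum, make the grid
    vertex-transitive, so the same strategy works everywhere and f_d does not
    depend on the starting vertex. *)

Set Implicit Arguments.
Unset Strict Implicit.
Unset Printing Implicit Defensive.

Import Order.TTheory GRing.Theory Num.Theory.

Lemma dist_in_le_leq (V : eqType) (adj : rel V) (A : V -> Prop) d e x y :
  d <= e -> dist_in_le adj A d x y -> dist_in_le adj A e x y.
Proof.
by move=> le_de [s [s_path s_last /leq_trans s_size sA]]; exists s; split; auto.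
Qed.

Lemma can_contain_leq (V : eqType) (adj : rel V) d e k u :
  d <= e -> can_contain adj d k u -> can_contain adj e k u.
Proof.
move=> le_de [p [[p0 p_move] p_cont]]; exists p; split=> //; split=> // t i.
exact: dist_in_le_leq le_de (p_move t i).
Qed.

Section Automorphism.

Variables (V : eqType) (adj : rel V) (f g : V -> V).
Hypotheses (fK : cancel f g) (gK : cancel g f).
Hypothesis f_adj : {mono f : x y / adj x y}.

Lemma protected_aut k (p : nat -> 'I_k -> V) t v :
  protected (fun s i => f (p s i)) t (f v) <-> protected p t v.
Proof.
split=> -[s [i [le_st Ep]]]; exists s, i; split=> //; last by rewrite Ep.
exact: (can_inj fK).
Qed.

Lemma burning_aut k u (p : nat -> 'I_k -> V) t v :
  burning adj (f u) (fun s i => f (p s i)) t (f v) <-> burning adj u p t v.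
Proof.
elim: t v => [|t IHt] v /=; first by split=> [/(can_inj fK)|->].
rewrite IHt protected_aut; split=> -[|[nPv [w [bw wv]]]]; try by left.
  by right; split=> //; exists (g w); rewrite -IHt -f_adj gK.
by right; split=> //; exists (f w); rewrite IHt f_adj.
Qed.

(** Fire, protection and the walks of the firefighters are all carried along by [f], so the image of
    a winning strategy wins from the image vertex. *)
Lemma can_contain_aut d k u :
  can_contain adj d k u -> can_contain adj d k (f u).
Proof.
move=> [p [[p0 p_move] [t p_cont]]]; exists (fun s i => f (p s i)); split.
  split=> [i|s i]; first by rewrite burning_aut.
  have [r [r_path r_last r_size r_safe]] := p_move s i.
  exists (map f r); split; rewrite ?size_map ?last_map ?r_last //.
    by rewrite path_map (eq_path (e' := adj)).
  move=> v; rewrite -map_cons => /mapP[w w_r ->].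
  by rewrite burning_aut; apply: r_safe.
exists t => -[v [w [+ + + +]]]; rewrite -(gK v) -(gK w) f_adj.
rewrite !burning_aut protected_aut => bv vw nbw npw; apply: p_cont.
by exists (g v), (g w).
Qed.

End Automorphism.

Section ComputedFire.

Variables (V : eqType) (adj : rel V) (nbrs : V -> seq V).
Hypothesis nbrsE : forall v w, (w \in nbrs v) = adj v w.
Variables (k : nat) (u : V) (P : nat -> k.-tuple V).

Definition positions t i := tnth (P t) i.

Definition guarded t : seq V := flatten [seq tval (P s) | s <- iota 0 t.+1].

(** An executable counterpart of [burning]; [undup] keeps the list from filling up with repetitions
    when it is evaluated. *)
Fixpoint fire t : seq V :=
  if t is t'.+1 then
    let b := fire t' in
    undup (b ++ [seq v <- flatten (map nbrs b) | v \notin guarded t'])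
  else [:: u].

Lemma protectedP t v : reflect (protected positions t v) (v \in guarded t).
Proof.
apply: (iffP flatten_mapP) => [[s]|[s [i [le_st <-]]]].
  by rewrite mem_iota add0n ltnS => le_st /tnthP[i ->]; exists s, i.
by exists s; rewrite ?mem_tnth // mem_iota add0n ltnS.
Qed.

Lemma burningP t v : reflect (burning adj u positions t v) (v \in fire t).
Proof.
elim: t v => [|t IHt] v; first by rewrite inE; apply: eqP.
rewrite /= mem_undup mem_cat mem_filter; apply: (iffP orP).
  case=> [/IHt|/andP[nPv /flatten_mapP[w /IHt bw wv]]]; [by left | right].
  by rewrite nbrsE in wv; split; [exact/protectedP | exists w].
case=> [/IHt|[/protectedP nPv [w [/IHt bw wv]]]]; [by left | right].
by rewrite nPv; apply/flatten_mapP; exists w; rewrite ?nbrsE.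
Qed.

(** Ignition after turn [s] would require [v] to be unprotected. This reduces safety at all later
    turns to one computation at turn [s]. *)
Lemma protected_not_burning s t v :
  s <= t -> v \in guarded s -> v \notin fire s ->
  ~ burning adj u positions t v.
Proof.
move=> le_st /protectedP[r [i [le_rs Ep]]] /burningP.
elim: t le_st => [|t IHt]; first by rewrite leqn0 => /eqP->.
rewrite leq_eqVlt ltnS => /predU1P[->//|le_st /(IHt le_st) nbv [//|[+ _]]].
by case; exists r, i; split=> //; apply: leq_trans le_st.
Qed.

Lemma contained_atP t :
  reflect (contained_at adj u positions t)
    (all (fun v => all (mem (fire t ++ guarded t)) (nbrs v)) (fire t)).
Proof.
apply: (iffP allP) => [cont [v [w [/burningP/cont/allP vP vw]]]|cont v bv].
  have := vP w; rewrite nbrsE inE mem_cat => /(_ vw)/orP[/burningP|/protectedP] //.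
apply/allP=> w; rewrite nbrsE inE mem_cat => vw.
apply/negPn/negP=> /norP[/burningP nbw /protectedP npw].
by apply: cont; exists v, w; split=> //; apply/burningP.
Qed.

Lemma dist_in_leP t d x s :
  path adj x s -> size s <= d -> all (predC (mem (fire t))) (x :: s) ->
  dist_in_le adj (fun v => ~ burning adj u positions t v) d x (last x s).
Proof.
by move=> s_path s_size /allP sP; exists s; split=> // v /sP/burningP.
Qed.

End ComputedFire.

(** The vertical edge at a vertex goes down when the coordinate sum is even and up when it is
    odd. *)
Definition hex_nbrs (v : int * int) : seq (int * int) :=
  [:: (v.1 + 1, v.2); (v.1 - 1, v.2);
      (v.1, if (2 %| v.1 + v.2)%Z then v.2 - 1 else v.2 + 1)]%R.

Lemma hex_nbrsE v w : (w \in hex_nbrs v) = hex_adj v w.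
Proof.
case: v w => [x y] [x' y'].
rewrite !inE /hex_adj /hex_arc !xpair_eqE /=.
by case: ifP; lia.
Qed.

(** The default of [nth] is the final position: from turn 4 on both firefighters stand on (0,
    -3). *)
Definition hex_strategy (t : nat) : 2.-tuple (int * int) :=
  nth [tuple (0, -3); (0, -3)]%Z
    [:: [tuple (1, 0); (-1, 0)];
        [tuple (2, -1); (-2, -1)];
        [tuple (3, -2); (-3, -2)];
        [tuple (2, -3); (-2, -3)]]%Z t.

(** Middle vertices of the walks of length two made on turn [t.+1], for [t < 4]. The vertices (2,
    -2) and (-2, -2) are crossed on turn 3 and burn only on turn 4. *)
Definition hex_midpoint (t : nat) : 2.-tuple (int * int) :=
  nth [tuple (0, -3); (0, -3)]%Z
    [:: [tuple (2, 0); (-2, 0)];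
        [tuple (3, -1); (-3, -1)];
        [tuple (2, -2); (-2, -2)];
        [tuple (1, -3); (-1, -3)]]%Z t.

Lemma can_contain_hex_origin : can_contain hex_adj 2 2 (0, 0)%Z.
Proof.
exists (positions hex_strategy); split; last first.
  by exists 4; apply/(contained_atP hex_nbrsE); vm_compute.
split=> [i|t i].
  apply/(burningP hex_nbrsE).
  by case: i => [[|[|//]] i2]; vm_compute.
(* From turn 4 on the walks are empty, and it remains only to see that (0, -3) never burns; the four
   earlier moves are checked by computation. *)
have [le4t|] := leqP 4 t.
  have E s : 4 <= s -> positions hex_strategy s i = (0, -3)%Z.
    by move: i s => [[|[|//]] i2] [|[|[|[|[|s]]]]].
  exists [::]; rewrite !E ?(leqW le4t) //; split=> // v; rewrite inE => /eqP->.
  by apply: (protected_not_burning hex_nbrsE (leqW le4t)); vm_compute.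
move=> lt_t4.
have -> : positions hex_strategy t.+1 i =
  last (positions hex_strategy t i)
    [:: tnth (hex_midpoint t) i; positions hex_strategy t.+1 i] by [].
case: i => [[|[|//]] i2]; move: t lt_t4 => [|[|[|[|//]]]] _;
  by apply: (dist_in_leP hex_nbrsE); vm_compute.
Qed.

Lemma can_contain_hex_transitive d k (u v : int * int) :
  can_contain hex_adj d k u -> can_contain hex_adj d k v.
Proof.
(* A translation respects the vertical edges when it preserves the parity of coordinate sums, which
   settles the even case. *)
have [uv_even|uv_odd] := boolP (2 %| (v.1 - u.1 + (v.2 - u.2))%R)%Z.
  pose f (q : int * int) := (q.1 + (v.1 - u.1), q.2 + (v.2 - u.2))%R.
  pose g (q : int * int) := (q.1 - (v.1 - u.1), q.2 - (v.2 - u.2))%R.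
  have -> : v = f u by rewrite /f !subrKC -surjective_pairing.
  have fK : cancel f g by move=> [x y]; rewrite /f /g /= !addrK.
  have gK : cancel g f by move=> [x y]; rewrite /f /g /= !subrK.
  apply: (can_contain_aut fK gK) => -[x y] [x' y']; rewrite /f /=.
  move: uv_even; move: (v.1 - u.1)%R (v.2 - u.2)%R => a b ab_even.
  have E (z w : int) : (2 %| (z + a + (w + b))%R)%Z = (2 %| (z + w)%R)%Z by lia.
  have addI c (z w : int) : (z + c == w + c)%R = (z == w) by lia.
  by rewrite /hex_adj /hex_arc !xpair_eqE /= !E ![(_ + _ + 1)%R]addrAC !addI.
(* The point reflection exchanging [u] and [v] flips parity and turns the grid upside down. The two
   effects cancel on vertical edges, so every arc is just reversed. *)
pose f (q : int * int) := (u.1 + v.1 - q.1, u.2 + v.2 - q.2)%R.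
have fK : involutive f by move=> [x y]; rewrite /f /= !subKr.
have -> : v = f u by rewrite /f ![(_ + _ - _)%R]addrAC !subrr !add0r -surjective_pairing.
have f_arc p q : hex_arc (f p) (f q) = hex_arc q p.
  move: uv_odd; case: p q => [x y] [x' y']; rewrite /hex_arc !xpair_eqE /=.
  move: (u.1) (u.2) (v.1) (v.2) => a b a' b' odd_ab.
  have subE c (z w : int) : (c - z == c - w)%R = (w == z) by lia.
  have subE1 c (z w : int) : (c - z == c - w + 1)%R = (w == z + 1)%R by lia.
  rewrite !subE !subE1; congr (_ || _).
  by have [->|] := eqVneq y (y' + 1)%R; have [->|] := eqVneq x x'; lia.
apply: (can_contain_aut fK fK) => p q.
by rewrite /hex_adj !f_arc orbC.
Qed.

Theorem lemma5p2 (d : nat) (hd : 2 <= d) :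
  (forall u : int * int, can_contain hex_adj d 2 u) /\
  (exists k : nat, k <= 2 /\ is_firefighter_number hex_adj d k).
Proof.
have can2 u : can_contain hex_adj d 2 u.
  apply: can_contain_hex_transitive.
  exact: can_contain_leq hd can_contain_hex_origin.
split=> //.
have least n : can_contain hex_adj d n (0, 0)%Z -> exists k, k <= n /\
    is_firefighter_number_at hex_adj d (0, 0)%Z k.
  elim/ltn_ind: n => n IHn can_n.
  (* Containment is not a decidable predicate here, so the least number of firefighters is found by
     strong induction with excluded middle. *)
  have [[j lt_jn can_j]|n_min] :=
      classic (exists2 j, j < n & can_contain hex_adj d j (0, 0)%Z).
    have [k [le_kj k_min]] := IHn j lt_jn can_j.
    by exists k; split=> //; apply: leq_trans le_kj (ltnW lt_jn).
  exists n; split=> //; split=> // j can_j; rewrite leqNgt.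
  by apply/negP=> lt_jn; apply: n_min; exists j.
have [k [le_k2 [can_k min_k]]] := least 2 (can2 _).
(* Transitivity is used both ways: the strategy moves from the origin to [u], and any strategy at
   [u] moves back to the origin, where [k] is minimal. *)
exists k; split=> // u; split; first exact: can_contain_hex_transitive can_k.
by move=> j /can_contain_hex_transitive/min_k.
Qed.
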